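(* There is an algorithm that, given a finite tree $T$ rooted at $r$ with a positive length function $\ell$ on its edges, computes an optimal valid budget allocation for $(T,r)$ (and the value $\operatorname{BR}(T,r)$) in time linear in the size of $T$ (counting arithmetic operations, including square roots, as unit cost).
   Context: A valid budget allocation to the edge set $E$ of $T$ is ${\mathcal B}:E\to\mathbb{R}_{\ge 0}$ with $\sum_{e\in E}{\mathcal B}(e)=1$. The weight of an edge is $\omega_{{\mathcal B}}(e)=\ell(e)/{\mathcal B}(e)$ ($+\infty$ if ${\mathcal B}(e)=0$); $\delta_{{\mathcal B}}(u,v)$ is the minimum total weight of a simple path from $u$ to $v$; $\operatorname{wr}_{{\mathcal B}}(r)=\max_v\delta_{{\mathcal B}}(r,v)$. An optimal valid budget allocation for $(T,r)$ is a valid allocation minimizing $\operatorname{wr}_{{\mathcal B}}(r)$, and $\operatorname{BR}(T,r)$ is that minimum value. *)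

(* Defs.v *)
From HB Require Import structures.
From mathcomp Require Import all_boot all_order all_algebra.
From mathcomp Require Import classical_sets reals ereal.

Set Implicit Arguments.
Unset Strict Implicit.
Unset Printing Implicit Defensive.

Import Order.TTheory GRing.Theory Num.Theory.

Local Open Scope classical_set_scope.
Local Open Scope ring_scope.

(* A finite undirected graph has vertices V, edges E, and an incidence map
   [ends]; the order of the two endpoints of an edge is irrelevant.  A walk from
   u is the sequence of the (edge, next vertex) pairs that it follows. *)
Section Graph.

Variables (V E : finType) (ends : E -> V * V).

Definition step (u : V) (x : E * V) : bool :=
  (ends x.1 == (u, x.2)) || (ends x.1 == (x.2, u)).

Fixpoint walk (u : V) (p : seq (E * V)) : bool :=
  if p is x :: q then step u x && walk x.2 q else true.

Definition target (u : V) (p : seq (E * V)) : V := last u (unzip2 p).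

Definition simple_path (u v : V) (p : seq (E * V)) : bool :=
  [&& walk u p, target u p == v & uniq (u :: unzip2 p)].

(* Loops and pairs of parallel edges are cycles, so a tree is a simple graph. *)
Definition is_cycle (u : V) (p : seq (E * V)) : bool :=
  [&& p != [::], walk u p, target u p == u, uniq (unzip1 p) & uniq (unzip2 p)].

Definition connected_graph : Prop :=
  forall u v, exists p, walk u p /\ target u p = v.

Definition acyclic_graph : Prop := forall u p, ~ is_cycle u p.

(* Nonemptiness of V comes from the root, which is always given with a tree. *)
Definition is_tree : Prop := connected_graph /\ acyclic_graph.

Section Budget.

Variables (R : realType) (len : E -> R).

Definition valid_budget (B : E -> R) : Prop :=
  (forall e, 0 <= B e) /\ \sum_(e : E) B e = 1.

Definition weight (B : E -> R) (e : E) : \bar R :=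
  if B e == 0 then +oo%E else (len e / B e)%:E.

Definition path_weight (B : E -> R) (p : seq (E * V)) : \bar R :=
  (\sum_(x <- p) weight B x.1)%E.

(* There are finitely many simple paths, and at least one when the graph is
   connected, so this infimum is then a minimum. *)
Definition delta (B : E -> R) (u v : V) : \bar R :=
  ereal_inf [set path_weight B p | p in [set p | simple_path u v p]].

Definition wr (B : E -> R) (r : V) : \bar R :=
  \big[maxe/-oo%E]_(v : V) delta B r v.

Definition optimal_budget (r : V) (B : E -> R) : Prop :=
  valid_budget B /\ forall B', valid_budget B' -> (wr B r <= wr B' r)%E.

(* When an optimal allocation exists, this is the value that it attains. *)
Definition BR (r : V) : \bar R := ereal_inf [set wr B r | B in valid_budget].

End Budget.

End Graph.

(* The computation model is a real RAM, programmed in a structured language.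
   The memory consists of arrays of natural numbers and arrays of real numbers,
   with computed indices; the name of an array is fixed in the program text, so
   a given program uses finitely many arrays, and cell 0 of an array serves as
   a scalar variable.  The only operations on natural numbers are addition and
   truncated subtraction, and there is no conversion between the two sorts; in
   particular there is no rounding of reals and no integer multiplication. *)
Inductive nexp : Type :=
  | NConst of nat
  | NGet of nat & nexp
  | NAdd of nexp & nexp
  | NSub of nexp & nexp.

Inductive rexp : Type :=
  | RConst of nat
  | RGet of nat & nexp
  | RAdd of rexp & rexp
  | RSub of rexp & rexp
  | RMul of rexp & rexp
  | RDiv of rexp & rexp
  | RSqrt of rexp.

Inductive bexp : Type :=
  | BLtN of nexp & nexp
  | BEqN of nexp & nexp
  | BLtR of rexp & rexp
  | BNot of bexp
  | BAnd of bexp & bexp.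

(* [NSet a i x] and [RSet a i x] perform the assignment a[i] := x. *)
Inductive cmd : Type :=
  | Skip
  | NSet of nat & nexp & nexp
  | RSet of nat & nexp & rexp
  | Seq of cmd & cmd
  | If of bexp & cmd & cmd
  | While of bexp & cmd.

(* Every constant, memory access, arithmetic operation (square roots included),
   comparison and Boolean connective costs one time unit. *)
Fixpoint ncost (e : nexp) : nat :=
  match e with
  | NConst _ => 1
  | NGet _ i => (ncost i).+1
  | NAdd e1 e2 | NSub e1 e2 => (ncost e1 + ncost e2).+1
  end.

Fixpoint rcost (e : rexp) : nat :=
  match e with
  | RConst _ => 1
  | RGet _ i => (ncost i).+1
  | RAdd e1 e2 | RSub e1 e2 | RMul e1 e2 | RDiv e1 e2 =>
      (rcost e1 + rcost e2).+1
  | RSqrt e1 => (rcost e1).+1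
  end.

Fixpoint bcost (b : bexp) : nat :=
  match b with
  | BLtN e1 e2 | BEqN e1 e2 => (ncost e1 + ncost e2).+1
  | BLtR e1 e2 => (rcost e1 + rcost e2).+1
  | BNot b1 => (bcost b1).+1
  | BAnd b1 b2 => (bcost b1 + bcost b2).+1
  end.

Section Machine.

Variable R : realType.

Record state : Type := State {
  nmem : nat -> nat -> nat;
  rmem : nat -> nat -> R }.

Definition update (T : Type) (mem : nat -> nat -> T) (a i : nat) (x : T)
    : nat -> nat -> T :=
  fun a' i' => if (a' == a) && (i' == i) then x else mem a' i'.

Fixpoint neval (s : state) (e : nexp) : nat :=
  match e with
  | NConst c => c
  | NGet a i => nmem s a (neval s i)
  | NAdd e1 e2 => (neval s e1 + neval s e2)%N
  | NSub e1 e2 => (neval s e1 - neval s e2)%N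
  end.

(* Division by 0 and the square root of a negative number return 0; a program
   could get the same effect by a comparison at constant cost. *)
Fixpoint reval (s : state) (e : rexp) : R :=
  match e with
  | RConst c => c%:R
  | RGet a i => rmem s a (neval s i)
  | RAdd e1 e2 => reval s e1 + reval s e2
  | RSub e1 e2 => reval s e1 - reval s e2
  | RMul e1 e2 => reval s e1 * reval s e2
  | RDiv e1 e2 => reval s e1 / reval s e2
  | RSqrt e1 => Num.sqrt (reval s e1)
  end.

Fixpoint beval (s : state) (b : bexp) : bool :=
  match b with
  | BLtN e1 e2 => (neval s e1 < neval s e2)%N
  | BEqN e1 e2 => neval s e1 == neval s e2
  | BLtR e1 e2 => reval s e1 < reval s e2
  | BNot b1 => ~~ beval s b1
  | BAnd b1 b2 => beval s b1 && beval s b2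
  end.

(* [exec c s t s'] : started in state s, the command c terminates in state s'
   after t time units. *)
Inductive exec : cmd -> state -> nat -> state -> Prop :=
  | ExecSkip s : exec Skip s 1 s
  | ExecNSet s a i e :
      exec (NSet a i e) s (ncost i + ncost e).+1
        (State (update (nmem s) a (neval s i) (neval s e)) (rmem s))
  | ExecRSet s a i e :
      exec (RSet a i e) s (ncost i + rcost e).+1
        (State (nmem s) (update (rmem s) a (neval s i) (reval s e)))
  | ExecSeq c1 c2 s1 s2 s3 t1 t2 :
      exec c1 s1 t1 s2 -> exec c2 s2 t2 s3 ->
      exec (Seq c1 c2) s1 (t1 + t2)%N s3
  | ExecIf b c1 c2 s s' t :
      exec (if beval s b then c1 else c2) s t s' ->
      exec (If b c1 c2) s (bcost b + t)%N s'
  | ExecWhileStop b c s :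
      ~~ beval s b -> exec (While b c) s (bcost b) s
  | ExecWhileLoop b c s1 s2 s3 t1 t2 :
      beval s1 b -> exec c s1 t1 s2 -> exec (While b c) s2 t2 s3 ->
      exec (While b c) s1 (bcost b + t1 + t2)%N s3.

(* The input is an edge list, with vertices and edges numbered arbitrarily:
     natural array 0 : number of vertices, number of edges, root;
     natural arrays 1 and 2 : first and second endpoint of each edge;
     real array 0 : length of each edge.
   All other cells are 0. *)
Definition input (n m : nat) (ends : 'I_m -> 'I_n * 'I_n) (len : 'I_m -> R)
    (r : 'I_n) : state :=
  State
    (fun a i => match a with
       | 0 => nth 0%N [:: n; m; val r] i
       | 1 => nth 0%N [seq val (ends e).1 | e <- enum 'I_m] i
       | 2 => nth 0%N [seq val (ends e).2 | e <- enum 'I_m] i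
       | _ => 0%N
       end)
    (fun a i => match a with
       | 0 => nth 0 [seq len e | e <- enum 'I_m] i
       | _ => 0
       end).

(* The output is the budget of each edge in real array 1, and the optimal value
   in cell 0 of real array 2. *)
Definition output_budget (m : nat) (s : state) : 'I_m -> R :=
  fun e => rmem s 1 (val e).

Definition output_value (s : state) : R := rmem s 2 0.

End Machine.

(* Main.v *)
(* Let S(v) be the optimum for the subtree below v.  An edge of length l down to
   a child c and the subtree below c share a budget b optimally at cost
   (sqrt l + sqrt S(c))^2 / b, and sibling branches should have equal costs;
   hence S(v) is the sum over the children c of v of (sqrt l + sqrt S(c))^2.
   Send a unit flow f from the root to the leaves that splits at v in proportion
   to these terms.  The budget sqrt(f l / S(r)) puts v at distance
   S(r) - sqrt(S(r) S(v) / f(v)) from r, so it attains S(r); that it sums to 1 is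
   a telescoping sum of sqrt(f S).  Conversely, for any budget B of value M, the
   flow average of the leaf distances gives sum_e f l / B <= M, while
   Cauchy-Schwarz gives sum_e f l / B >= (sum_e sqrt(f l))^2 = S(r).

   The program computes S by pruning leaves, and then f in the reverse order.  It
   needs no adjacency lists: for each vertex it keeps the number and the sum of
   the indices of the remaining incident edges, and when one edge remains, the
   sum is its index. *)

Require Import Defs.
From HB Require Import structures.
From mathcomp Require Import all_boot all_order all_algebra.
From mathcomp Require Import classical_sets reals ereal.
From mathcomp Require Import ring lra.

Set Implicit Arguments.
Unset Strict Implicit.
Unset Printing Implicit Defensive.

Import Order.TTheory GRing.Theory Num.Theory.

Local Open Scope ring_scope.

(** * Rooted trees *)

Section Rooting.

Variables (V E : finType) (ends : E -> V * V) (r : V).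

(* [e] joins the child [ch e] to its parent [pa e].  Everything is indexed by
   edges because a root alone has no edge to serve as a default. *)
Record rooting (ch pa : E -> V) (dep : V -> nat) : Prop := Rooting {
  rooting_step : forall e, step ends (pa e) (e, ch e);
  rooting_depth : forall e, dep (ch e) = (dep (pa e)).+1;
  rooting_inj : injective ch;
  rooting_neq_root : forall e, ch e != r;
  rooting_surj : forall v, v != r -> exists e, ch e = v }.

Lemma step_sym u e v : step ends u (e, v) = step ends v (e, u).
Proof. by rewrite /step /= orbC. Qed.

Lemma step_ends u x : step ends u x ->
  ((ends x.1).1 == u) && ((ends x.1).2 == x.2) ||
  ((ends x.1).1 == x.2) && ((ends x.1).2 == u).
Proof. by case/orP => /eqP -> /=; rewrite !eqxx ?orbT. Qed.

Lemma walk_mem_ends u p e : walk ends u p -> e \in unzip1 p ->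
  ((ends e).1 \in u :: unzip2 p) && ((ends e).2 \in u :: unzip2 p).
Proof.
elim: p u => [//|x p IH] u /= /andP[ux wp]; rewrite inE => /predU1P[->|ep].
  by case/orP: (step_ends ux) => /andP[/eqP-> /eqP->]; rewrite !inE !eqxx !orbT.
by have /andP[h1 h2] := IH _ wp ep; rewrite 2!(in_cons u) h1 h2 !orbT.
Qed.

(** If the first edge occurred again later, both its endpoints, hence [u] itself, would lie on the
    rest of the walk. *)
Lemma walk_uniq_edges u p :
  walk ends u p -> uniq (u :: unzip2 p) -> uniq (unzip1 p).
Proof.
elim: p u => [//|[e v] p IH] u /andP[ux wp] uuq.
have /andP[unp uvp] : (u \notin v :: unzip2 p) && uniq (v :: unzip2 p) by [].
rewrite /= (IH v) // andbT; apply/negP => ep.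
have /andP[h1 h2] := walk_mem_ends wp ep.
by case/orP: (step_ends ux) => /andP[/eqP a1 /eqP a2];
  move: unp; rewrite -?a1 -?a2 ?h1 ?h2.
Qed.

Definition adj (u v : V) : bool := [exists e, step ends u (e, v)].

(** The ball of radius [k] about [r]. Its membership is decidable, so [ex_minn] can extract the
    distance to [r]. *)
Definition level (k : nat) : {set V} :=
  iter k (fun A => A :|: [set v | [exists u in A, adj u v]]) [set r].

Lemma level_adj k u v : u \in level k -> adj u v -> v \in level k.+1.
Proof.
move=> uk uv; rewrite /= !inE; apply/orP; right.
by apply/existsP; exists u; rewrite uk.
Qed.

Lemma level_target k u p :
  u \in level k -> walk ends u p -> target u p \in level (k + size p).
Proof.
elim: p k u => [|[e v] p IH] k u uk /=; first by rewrite addn0.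
case/andP=> us wp; rewrite addnS -addSn; apply: IH wp.
by apply: level_adj uk _; apply/existsP; exists e.
Qed.

(** Depth is the distance to [r], and each other vertex chooses an edge to a vertex one level
    closer. The chosen edges already connect the graph, so acyclicity leaves room for no others. *)
Lemma tree_rooting : is_tree ends -> exists ch pa dep, rooting ch pa dep.
Proof.
case=> conn acyc.
have lev v : exists k, v \in level k.
  have [p [wp <-]] := conn r v; exists (0 + size p)%N.
  by apply: level_target wp; rewrite inE.
pose dep v := ex_minn (lev v).
have dep_in v : v \in level (dep v) by rewrite /dep; case: ex_minnP.
have dep_le v k : v \in level k -> (dep v <= k)%N.
  by rewrite /dep; case: ex_minnP => d _; apply.
have dep_root : dep r = 0%N by apply/eqP; rewrite -leqn0 dep_le // inE.
have dep_parent v : v != r ->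
    exists e u, step ends u (e, v) /\ dep v = (dep u).+1.
  move=> vr; have := dep_in v; case dv: (dep v) => [|k].
    by rewrite inE (negPf vr).
  rewrite /= !inE => /orP[/dep_le|]; first by rewrite dv ltnn.
  case/exists_inP=> u uk /[dup] uv /existsP[e us]; exists e, u; split=> //.
  congr _.+1; apply/eqP; rewrite eqn_leq (dep_le _ _ uk) andbT -ltnS -dv.
  by apply: dep_le; apply: level_adj uv.
pose isp e v := [exists u, step ends u (e, v) && (dep v == (dep u).+1)].
pose pe v := [pick e | isp e v].
have peP v e : pe v = Some e -> isp e v.
  by rewrite /pe; case: pickP => // e' ? [<-].
have pe_ex v : v != r -> exists e, pe v = Some e.
  case/dep_parent => e [u [us dv]]; rewrite /pe; case: pickP => [e' _|/(_ e)].
    by exists e'.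
  by rewrite /isp => /existsP; case; exists u; rewrite us dv eqxx.
(* Otherwise each endpoint of [e] would be one level below the other. *)
have isp_inj e v v' : isp e v -> isp e v' -> v = v'.
  have no2 k : k = k.+2 -> False by elim: k => // k IH [/IH].
  case/existsP=> u /andP[/step_ends us /eqP d].
  case/existsP=> u' /andP[/step_ends us' /eqP d']; move: us us'; rewrite /=.
  case/orP=> /andP[/eqP-> /eqP->] /orP[] /andP[/eqP h1 /eqP h2] //;
    by move: d'; rewrite -h1 -h2 d => /no2.
pose tedge e := [exists v, pe v == Some e].
pose tadj u v := [exists e, tedge e && step ends u (e, v)].
have tadj_sym : symmetric tadj.
  by move=> u v; apply: eq_existsb => e; rewrite step_sym.
have to_root k v : (dep v <= k)%N -> connect tadj v r.
  elim: k v => [|k IH] v dv; have [->|vr] := eqVneq v r; rewrite ?connect0 //.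
    by have [e [u [_ d]]] := dep_parent v vr; rewrite d in dv.
  have [e ev] := pe_ex _ vr.
  have /existsP[u /andP[us /eqP d]] := peP _ _ ev.
  apply: (@connect_trans _ _ u); last by apply: IH; rewrite -ltnS -d.
  apply: connect1; apply/existsP; exists e; rewrite step_sym us andbT.
  by apply/existsP; exists v; rewrite ev.
have tconn u v : connect tadj u v.
  apply: (@connect_trans _ _ r); first exact: (to_root (dep u)).
  by rewrite (sym_connect_sym tadj_sym) (to_root (dep v)).
have twalk u p : path tadj u p -> exists q,
    [/\ unzip2 q = p, walk ends u q & all tedge (unzip1 q)].
  elim: p u => [|v p IH] u /=; first by exists [::].
  case/andP=> /existsP[e /andP[te us]] /IH [q [<- wq aq]].
  by exists ((e, v) :: q); split=> //=; [rewrite us|rewrite aq andbT].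
(* A simple path of chosen edges joins the endpoints of [e]; if [e] were not chosen, it would close
   this path into a cycle. *)
have all_tedge e : tedge e.
  apply: contraT => nte; case ee: (ends e) => [a b].
  have /connectP[p0 pp0] := tconn b a; case: (shortenP pp0) => p pp up _ ea.
  have [q [qp wq aq]] := twalk _ _ pp.
  case: (acyc a ((e, b) :: q)); apply/and5P; split=> //=.
  - by rewrite {1}/step /= ee eqxx.
  - by rewrite /target /= qp -ea.
  - rewrite (walk_uniq_edges wq) ?qp // andbT.
    by apply: contra nte => eq; apply: (allP aq).
  - by rewrite qp.
have child_ex e : exists v, pe v == Some e by apply/existsP/all_tedge.
pose ch e := xchoose (child_ex e).
have chP e : pe (ch e) = Some e by apply/eqP/(xchooseP (child_ex e)).
have parent_ex e : exists u, step ends u (e, ch e) && (dep (ch e) == (dep u).+1).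
  by apply/existsP/(peP _ _ (chP e)).
pose pa e := xchoose (parent_ex e).
have paP e : step ends (pa e) (e, ch e) && (dep (ch e) == (dep (pa e)).+1).
  exact: xchooseP (parent_ex e).
exists ch, pa, dep; split.
- by move=> e; case/andP: (paP e).
- by move=> e; case/andP: (paP e) => _ /eqP.
- by move=> e e' ee'; have := chP e; rewrite ee' chP => -[].
- by move=> e; apply/eqP => er; case/andP: (paP e); rewrite er dep_root.
- by move=> v /pe_ex[e ev]; exists e; apply: (isp_inj e); apply: peP.
Qed.

End Rooting.

(** * Induction and summation over a rooted tree *)

Section RootedTree.

Variables (V E : finType) (ends : E -> V * V) (r : V).
Variables (ch pa : E -> V) (dep : V -> nat).
Hypothesis rt : rooting ends r ch pa dep.

Lemma rooted_ind (P : V -> Prop) :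
  P r -> (forall e, P (pa e) -> P (ch e)) -> forall v, P v.
Proof.
move=> Pr Pch v; have [k] := ubnP (dep v); elim: k v => // k IH v.
have [->//|/(rooting_surj rt)[e <-]] := eqVneq v r.
by rewrite (rooting_depth rt) ltnS => /IH /Pch.
Qed.

Lemma rooted_ind_up (P : V -> Prop) :
  (forall v, (forall e, pa e = v -> P (ch e)) -> P v) -> forall v, P v.
Proof.
move=> Pv v; pose N := \max_v dep v.
have [k] := ubnP (N - dep v); elim: k v => // k IH v vk.
apply: Pv => e ev; apply: IH; rewrite (rooting_depth rt) ev.
have le: (dep (ch e) <= N)%N by apply: leq_bigmax.
rewrite (rooting_depth rt) ev in le.
by rewrite -ltnS (leq_trans _ vk) // ltnS subnS prednK // subn_gt0.
Qed.

Lemma ch_neq_pa e : ch e != pa e.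
Proof.
by apply/eqP => /(congr1 dep); rewrite (rooting_depth rt) => /eqP; elim: (dep _).
Qed.

Lemma rooting_ends e :
  ends e = (pa e, ch e) \/ ends e = (ch e, pa e).
Proof. by case/orP: (rooting_step rt e) => /eqP ->; [left|right]. Qed.

Lemma step_rooting u x : step ends u x ->
  (u = pa x.1 /\ x.2 = ch x.1) \/ (u = ch x.1 /\ x.2 = pa x.1).
Proof.
case: x => e v; rewrite /step /=.
by case: (rooting_ends e) => ->; case/orP => /eqP[-> ->]; [left|right|right|left].
Qed.

Section Sums.

Variable R : realType.

Lemma sum_children (F : E -> R) : \sum_v \sum_(e | pa e == v) F e = \sum_e F e.
Proof. by rewrite [RHS](partition_big pa predT). Qed.

(** Edges correspond bijectively to non-root vertices through [ch]. With [sum_children], this does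
    all the telescoping along the tree. *)
Lemma sum_vertices (g : V -> R) : \sum_v g v = g r + \sum_e g (ch e).
Proof.
rewrite (bigD1 r) //=; congr (_ + _).
rewrite -(big_map ch predT g) -[LHS]big_filter.
apply: perm_big; apply: uniq_perm.
- by rewrite filter_uniq // index_enum_uniq.
- by rewrite map_inj_uniq ?index_enum_uniq //; exact: (rooting_inj rt).
move=> v; rewrite mem_filter mem_index_enum andbT.
apply/idP/mapP => [/(rooting_surj rt)[e <-]|[e _ ->]].
  by exists e; rewrite ?mem_index_enum.
exact: (rooting_neq_root rt).
Qed.

End Sums.

End RootedTree.

(** * Distances from the root *)

Section RootDistance.

Variables (R : realType) (V E : finType) (ends : E -> V * V) (r : V).
Variables (ch pa : E -> V) (dep : V -> nat).
Hypothesis rt : rooting ends r ch pa dep.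

Local Open Scope ereal_scope.

(** Going up through parent edges is not structural recursion, so [k] serves as fuel; in [root_dist]
    it decreases in step with the depth. *)
Fixpoint climb (w : E -> \bar R) (k : nat) (v : V) : \bar R :=
  if k is k'.+1 then
    if [pick e | ch e == v] is Some e then climb w k' (pa e) + w e else 0
  else 0.

Definition root_dist (w : E -> \bar R) (v : V) : \bar R := climb w (dep v).+1 v.

Lemma root_dist_root w : root_dist w r = 0.
Proof.
rewrite /root_dist /=; case: pickP => // e /eqP er.
by have := rooting_neq_root rt e; rewrite er eqxx.
Qed.

Lemma root_dist_ch w e : root_dist w (ch e) = root_dist w (pa e) + w e.
Proof.
rewrite {1}/root_dist (rooting_depth rt) [LHS]/=.
by case: pickP => [e' /eqP/(rooting_inj rt)->//|/(_ e)]; rewrite eqxx.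
Qed.

Lemma root_dist_ge0 w : (forall e, 0 <= w e) -> forall v, 0 <= root_dist w v.
Proof.
move=> w0; apply: (rooted_ind rt); first by rewrite root_dist_root.
by move=> e IH; rewrite root_dist_ch adde_ge0.
Qed.

Variables (len B : E -> R).
Hypothesis len_gt0 : forall e, (0 < len e)%R.
Hypothesis B_ge0 : forall e, (0 <= B e)%R.

Local Notation w := (weight len B).

Lemma weight_ge0 e : 0 <= w e.
Proof.
by rewrite /weight; case: ifP => // _; rewrite lee_fin divr_ge0 // ltW.
Qed.

(** [root_dist] acts as a potential: a step down raises it by exactly the edge weight, and a step up
    cannot raise it because weights are nonnegative. *)
Lemma root_dist_walk u p :
  walk ends u p -> root_dist w (target u p) <= root_dist w u + path_weight len B p.
Proof.
elim: p u => [|x p IH] u /=; first by rewrite /path_weight big_nil adde0.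
case/andP=> ux /IH; rewrite /path_weight big_cons addeA => /le_trans; apply.
apply: leeD2r; case: (step_rooting rt ux) => -[-> ->].
  by rewrite root_dist_ch.
by rewrite root_dist_ch -addeA leeDl // adde_ge0 // weight_ge0.
Qed.

(** The depth bound strengthens the induction: the vertex appended next is deeper than all earlier
    ones, so the path stays simple. *)
Lemma root_path v : exists p,
  [/\ simple_path ends r v p, {in r :: unzip2 p, forall u, dep u <= dep v}%N
    & path_weight len B p = root_dist w v].
Proof.
elim/(rooted_ind rt): v => [|e [p [/and3P[wp /eqP tp up] dp wgt]]].
  exists [::]; split.
  - by rewrite /simple_path /target /= eqxx.
  - by move=> u; rewrite inE => /eqP->.
  - by rewrite /path_weight big_nil root_dist_root.
have map_rcons_p : unzip2 (rcons p (e, ch e)) = rcons (unzip2 p) (ch e).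
  by rewrite /unzip2 map_rcons.
exists (rcons p (e, ch e)); split.
- apply/and3P; split.
  + have walk_rcons u q x : walk ends u (rcons q x) =
        walk ends u q && step ends (target u q) x.
      by elim: q u => [|y q IHq] u /=; rewrite ?andbT // IHq andbA.
    by rewrite walk_rcons wp tp (rooting_step rt).
  + by rewrite /target map_rcons_p last_rcons.
  + rewrite map_rcons_p -rcons_cons rcons_uniq up andbT.
    by apply/negP => /dp; rewrite (rooting_depth rt) ltnn.
- move=> u; rewrite map_rcons_p -rcons_cons mem_rcons in_cons (rooting_depth rt).
  by case/predU1P=> [->|/dp/leqW//]; rewrite (rooting_depth rt).
- by rewrite root_dist_ch -wgt /path_weight -cats1 big_cat big_seq1.
Qed.

Lemma delta_root v : delta ends len B r v = root_dist w v.
Proof.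
apply/eqP; rewrite eq_le; apply/andP; split.
  by have [p [sp _ <-]] := root_path v; apply: ereal_inf_lbound; exists p.
apply/ereal_infP => _ [p /and3P[wp /eqP <- _] <-].
by have := root_dist_walk wp; rewrite root_dist_root add0e.
Qed.

End RootDistance.

(** * The optimal budget *)

Section OptimalBudget.

Variables (R : realType) (V E : finType) (ends : E -> V * V) (r : V).
Variables (ch pa : E -> V) (dep : V -> nat).
Hypothesis rt : rooting ends r ch pa dep.
Variable len : E -> R.
Hypothesis len_gt0 : forall e, 0 < len e.

(** Only the recurrences for [S] and [f] are assumed, so the arrays left in memory by the program
    can be substituted directly. *)
Variables S f : V -> R.

Local Notation a e := (Num.sqrt (len e) + Num.sqrt (S (ch e))).

Hypothesis S_rec : forall v, S v = \sum_(e | pa e == v) a e ^+ 2.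
Hypothesis f_root : f r = 1.
Hypothesis f_ch : forall e, f (ch e) = f (pa e) * (a e ^+ 2 / S (pa e)).

Lemma branch_gt0 e : 0 < a e.
Proof. by rewrite ltr_wpDr ?sqrtr_ge0 // sqrtr_gt0. Qed.

Lemma S_ge0 v : 0 <= S v.
Proof. by rewrite S_rec sumr_ge0 // => e _; rewrite sqr_ge0. Qed.

Lemma S_gt0 e : 0 < S (pa e).
Proof.
rewrite S_rec (bigD1 e) //= ltr_wpDr ?exprn_gt0 ?branch_gt0 //.
by apply: sumr_ge0 => e' _; rewrite sqr_ge0.
Qed.

Lemma f_gt0 v : 0 < f v.
Proof.
elim/(rooted_ind rt): v => [|e IH]; first by rewrite f_root.
by rewrite f_ch mulr_gt0 // divr_gt0 ?S_gt0 // exprn_gt0 // branch_gt0.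
Qed.

Lemma sqrt_f_ch e :
  Num.sqrt (f (ch e)) = Num.sqrt (f (pa e)) / Num.sqrt (S (pa e)) * a e.
Proof.
rewrite f_ch sqrtrM ?(ltW (f_gt0 _)) // sqrtrM ?sqr_ge0 // sqrtr_sqr.
by rewrite gtr0_norm ?branch_gt0 // sqrtrV ?S_ge0 // mulrA mulrAC.
Qed.

Lemma sqrt_f_S v : Num.sqrt (f v) * Num.sqrt (S v) =
  \sum_(e | pa e == v) Num.sqrt (f (ch e)) * a e.
Proof.
have -> : \sum_(e | pa e == v) Num.sqrt (f (ch e)) * a e =
          Num.sqrt (f v) / Num.sqrt (S v) * S v.
  rewrite {2}S_rec mulr_sumr; apply: eq_bigr => e /eqP <-.
  by rewrite sqrt_f_ch expr2 mulrA.
rewrite -{3}(sqr_sqrtr (S_ge0 v)) expr2 -mulrA; congr (_ * _).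
(* [S v] vanishes at a leaf, where both sides are 0. *)
have [->|nz] := eqVneq (Num.sqrt (S v)) 0; first by rewrite !mulr0.
by rewrite mulrA mulVf // mul1r.
Qed.

(** Sum [psi] over all vertices in two ways, by [sqrt_f_S] at each vertex and by the bijection with
    edges; the terms in [S (ch e)] cancel. *)
Lemma sqrt_S_root :
  Num.sqrt (S r) = \sum_e Num.sqrt (f (ch e)) * Num.sqrt (len e).
Proof.
pose psi v := Num.sqrt (f v) * Num.sqrt (S v).
have : \sum_v psi v = psi r + \sum_e psi (ch e) by apply: (sum_vertices rt).
have -> : \sum_v psi v = \sum_e Num.sqrt (f (ch e)) * a e.
  by rewrite -(sum_children pa); apply: eq_bigr => v _; apply: sqrt_f_S.
under eq_bigr do rewrite mulrDr.
by rewrite big_split /= => /addIr ->; rewrite /psi f_root sqrtr1 mul1r.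
Qed.

Hypothesis E_inhabited : inhabited E.

(** The given edge may be far from the root, so positivity is read off the global formula
    [sqrt_S_root] and not off the recurrence at [r]. *)
Lemma S_root_gt0 : 0 < S r.
Proof.
case: E_inhabited => e; rewrite -sqrtr_gt0 sqrt_S_root (bigD1 e) //=.
rewrite ltr_wpDr ?mulr_gt0 ?sqrtr_gt0 ?f_gt0 //.
by apply: sumr_ge0 => e' _; rewrite mulr_ge0 ?sqrtr_ge0.
Qed.

Variable B : E -> R.
Hypothesis B_def : forall e, B e = Num.sqrt (f (ch e) * len e / S r).

Lemma B_sqrt e :
  B e = Num.sqrt (f (ch e)) * Num.sqrt (len e) / Num.sqrt (S r).
Proof.
have fl : 0 <= f (ch e) * len e by rewrite mulr_ge0 // ltW // f_gt0.
by rewrite B_def sqrtrM // sqrtrM ?(ltW (f_gt0 _)) // sqrtrV ?S_ge0.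
Qed.

Lemma B_gt0 e : 0 < B e.
Proof. by rewrite B_sqrt divr_gt0 ?mulr_gt0 ?sqrtr_gt0 ?f_gt0 ?S_root_gt0. Qed.

Lemma B_valid : valid_budget B.
Proof.
split=> [e|]; first by rewrite ltW ?B_gt0.
under eq_bigr do rewrite B_sqrt.
by rewrite -mulr_suml -sqrt_S_root divff // gt_eqF ?sqrtr_gt0 ?S_root_gt0.
Qed.

Lemma root_dist_B v : root_dist ch pa dep (weight len B) v =
  (S r - Num.sqrt (S r) * (Num.sqrt (S v) / Num.sqrt (f v)))%:E.
Proof.
elim/(rooted_ind rt): v => [|e IH].
  rewrite (root_dist_root rt) f_root sqrtr1 divr1 -expr2 sqr_sqrtr ?S_ge0 //.
  by rewrite subrr.
rewrite (root_dist_ch rt) IH /weight gt_eqF ?B_gt0 // -EFinD; congr _%:E.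
(* Expressed through square roots only, the identity becomes rational, within reach of [field]. *)
rewrite B_sqrt sqrt_f_ch -{1}(sqr_sqrtr (ltW (len_gt0 e))).
have := branch_gt0 e.
have [+ + + +] : [/\ 0 < Num.sqrt (S (pa e)), 0 < Num.sqrt (f (pa e)),
    0 < Num.sqrt (S r) & 0 < Num.sqrt (len e)].
  by rewrite !sqrtr_gt0 S_gt0 f_gt0 S_root_gt0 len_gt0.
set x := Num.sqrt (S (pa e)); set y := Num.sqrt (f (pa e)).
set s := Num.sqrt (S r); set l := Num.sqrt (len e); set z := Num.sqrt (S (ch e)).
by move=> x0 y0 s0 l0 lz0; field; rewrite !gt_eqF.
Qed.

Lemma wr_B : (wr ends len B r <= (S r)%:E)%E.
Proof.
apply/bigmax_leP; split=> [|v _]; first by rewrite leNye.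
rewrite (delta_root rt) ?root_dist_B; first last.
- by move=> e; rewrite ltW ?B_gt0.
- exact: len_gt0.
by rewrite lee_fin gerBl mulr_ge0 ?divr_ge0 ?sqrtr_ge0.
Qed.

Lemma wr_lower B' : valid_budget B' -> ((S r)%:E <= wr ends len B' r)%E.
Proof.
move=> [B'0 sB'].
have rd u : (root_dist ch pa dep (weight len B') u <= wr ends len B' r)%E.
  by rewrite -(delta_root rt) //; apply: le_bigmax.
case wrE : (wr ends len B' r) rd => [M| |] rd; last 2 first.
- by rewrite leey.
- have := le_trans (root_dist_ge0 rt (weight_ge0 len_gt0 B'0) r) (rd r).
  by rewrite leeNy_eq.
have rd0 := root_dist_ge0 rt (weight_ge0 len_gt0 B'0).
pose d v := fine (root_dist ch pa dep (weight len B') v).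
have dE v : root_dist ch pa dep (weight len B') v = (d v)%:E.
  by rewrite fineK // ge0_fin_numE // (le_lt_trans (rd v)) // ltry.
have dM v : d v <= M by rewrite -lee_fin -dE.
(* A zero budget would make the distance to [ch e] infinite. *)
have B'gt0 e : 0 < B' e.
  rewrite lt_neqAle B'0 andbT eq_sym; apply/negP => Be.
  by have := dE (ch e); rewrite (root_dist_ch rt) dE /weight Be.
have d_ch e : d (ch e) = d (pa e) + len e / B' e.
  by apply: EFin_inj; rewrite -dE (root_dist_ch rt) dE /weight gt_eqF.
have d_root : d r = 0 by apply: EFin_inj; rewrite -dE (root_dist_root rt).
(* Flow is conserved except at leaves, where the sum is empty. *)
have f_split v : \sum_(e | pa e == v) f (ch e) <= f v.
  rewrite (_ : \sum_(e | _) _ = f v / S v * S v); last first.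
    rewrite {2}S_rec mulr_sumr; apply: eq_bigr => e /eqP <-.
    by rewrite f_ch mulrA mulrAC.
  have [->|nz] := eqVneq (S v) 0; first by rewrite mulr0 ltW ?f_gt0.
  by rewrite divfK.
(* Summation by parts with the slack [M - d v]: it is nonnegative, so the outflow of [v] may be
   replaced by [f v], after which everything cancels except the term [M] of the root. *)
have flow_le : \sum_e f (ch e) * (len e / B' e) <= M.
  have -> : \sum_e f (ch e) * (len e / B' e) =
      \sum_v (M - d v) * (\sum_(e | pa e == v) f (ch e))
      - \sum_e (M - d (ch e)) * f (ch e).
    have -> : \sum_v (M - d v) * (\sum_(e | pa e == v) f (ch e)) =
        \sum_e (M - d (pa e)) * f (ch e).
      rewrite -[RHS](sum_children pa); apply: eq_bigr => v _; rewrite mulr_sumr.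
      by apply: eq_bigr => e /eqP ->.
    by rewrite -sumrB; apply: eq_bigr => e _; rewrite d_ch; ring.
  have le : \sum_v (M - d v) * (\sum_(e | pa e == v) f (ch e)) <=
      \sum_v (M - d v) * f v.
    by apply: ler_sum => v _; rewrite ler_wpM2l // subr_ge0.
  rewrite lerBlDr (le_trans le) // (sum_vertices rt) d_root f_root.
  by rewrite subr0 mulr1.
rewrite lee_fin (le_trans _ flow_le) //; set s := Num.sqrt (S r).
(* AM-GM on each edge: f l / B' + s^2 B' >= 2 s sqrt(f l); the sum over all
   edges is Cauchy-Schwarz, because B' sums to 1. *)
have edge_le e : 2 * s * (Num.sqrt (f (ch e)) * Num.sqrt (len e)) - s ^+ 2 * B' e
    <= f (ch e) * (len e / B' e).
  rewrite -{2}(sqr_sqrtr (ltW (f_gt0 (ch e)))) -{2}(sqr_sqrtr (ltW (len_gt0 e))).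
  set x := Num.sqrt (f (ch e)); set y := Num.sqrt (len e).
  have -> : x ^+ 2 * (y ^+ 2 / B' e) =
      (x * y - s * B' e) ^+ 2 / B' e + (2 * s * (x * y) - s ^+ 2 * B' e).
    by field; rewrite gt_eqF.
  by rewrite lerDr divr_ge0 ?sqr_ge0.
apply: le_trans (ler_sum _ (fun e _ => edge_le e)).
rewrite sumrB -!mulr_sumr -sqrt_S_root sB' -/s mulr1.
by rewrite -(sqr_sqrtr (S_ge0 r)) -/s; lra.
Qed.

Lemma B_optimal : optimal_budget ends len r B /\ (S r)%:E = BR ends len r.
Proof.
split; first split; first exact: B_valid.
  by move=> B' /wr_lower; apply: le_trans wr_B.
apply/eqP; rewrite eq_le; apply/andP; split.
  by apply/ereal_infP => _ [B' /wr_lower le <-].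
apply: le_trans wr_B; apply: ereal_inf_lbound; exists B => //.
exact: B_valid.
Qed.

End OptimalBudget.

(** * Cost bounds for programs *)

Section ProgramLogic.

Variable R : realType.
Implicit Types (s : state R) (c : cmd).

Fixpoint straight c : bool :=
  match c with
  | Seq c1 c2 | If _ c1 c2 => straight c1 && straight c2
  | While _ _ => false
  | _ => true
  end.

(** The value on [While] is a placeholder; the link to [exec] is made under [straight]. *)
Fixpoint run c s : state R :=
  match c with
  | NSet a i e => State (update (nmem s) a (neval s i) (neval s e)) (rmem s)
  | RSet a i e => State (nmem s) (update (rmem s) a (neval s i) (reval s e))
  | Seq c1 c2 => run c2 (run c1 s)
  | If b c1 c2 => if beval s b then run c1 s else run c2 s
  | Skip | While _ _ => s
  end.

Fixpoint max_cost c : nat :=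
  match c with
  | Skip => 1
  | NSet _ i e => (ncost i + ncost e).+1
  | RSet _ i e => (ncost i + rcost e).+1
  | Seq c1 c2 => max_cost c1 + max_cost c2
  | If b c1 c2 => bcost b + maxn (max_cost c1) (max_cost c2)
  | While _ _ => 0
  end.

(** A total-correctness judgement: termination within [T] is part of the claim. *)
Definition runs c s (T : nat) (Q : state R -> Prop) : Prop :=
  exists t s', [/\ exec c s t s', (t <= T)%N & Q s'].

Lemma runs_straight c s (Q : state R -> Prop) :
  straight c -> Q (run c s) -> runs c s (max_cost c) Q.
Proof.
move=> sc Qs.
suff [t [ex le]] : exists t, exec c s t (run c s) /\ (t <= max_cost c)%N.
  by exists t, (run c s).
elim: c s sc {Q Qs} => [|a i e|a i e|c1 IH1 c2 IH2|b c1 IH1 c2 IH2|//] s /=.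
- by exists 1%N; split=> //; constructor.
- by move=> _; eexists; split; [constructor|].
- by move=> _; eexists; split; [constructor|].
- case/andP=> /(IH1 s)[t1 [e1 l1]] /(IH2 (run c1 s))[t2 [e2 l2]].
  by exists (t1 + t2)%N; split; [apply: ExecSeq e1 e2 | apply: leq_add].
- case/andP=> /(IH1 s)[t1 [e1 l1]] /(IH2 s)[t2 [e2 l2]].
  exists (bcost b + if beval s b then t1 else t2)%N; split.
    by constructor; case: ifP.
  by rewrite leq_add2l leq_max; case: ifP; rewrite ?l1 ?l2 ?orbT.
Qed.

Lemma runs_seq c1 c2 s T1 T2 (P Q : state R -> Prop) :
  runs c1 s T1 P -> (forall s', P s' -> runs c2 s' T2 Q) ->
  runs (Seq c1 c2) s (T1 + T2) Q.
Proof.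
case=> t1 [s1 [e1 l1 /[swap]/[apply]]] [t2 [s2 [e2 l2 Qs]]].
by exists (t1 + t2)%N, s2; split; [apply: ExecSeq e1 e2 | apply: leq_add|].
Qed.

Lemma runs_imply c s T (P Q : state R -> Prop) :
  (forall s', P s' -> Q s') -> runs c s T P -> runs c s T Q.
Proof. by move=> PQ [t [s' [e l /PQ]]]; exists t, s'. Qed.

Lemma runs_le c s T T' (Q : state R -> Prop) :
  (T <= T')%N -> runs c s T Q -> runs c s T' Q.
Proof.
by move=> TT' [t [s' [e l q]]]; exists t, s'; split=> //; apply: leq_trans TT'.
Qed.

(** The index of the invariant is a variant: it drops strictly at each iteration, so its initial
    value bounds their number. *)
Lemma runs_while b c (I : nat -> state R -> Prop) s k :
    straight c -> I k s ->
    (forall j s', I j s' -> beval s' b ->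
       exists2 j', (j' < j)%N & I j' (run c s')) ->
  runs (While b c) s (bcost b + k * (bcost b + max_cost c))
    (fun s' => ~~ beval s' b /\ exists j, I j s').
Proof.
move=> sc Is Istep; elim/ltn_ind: k => k IH in s Is *.
case bs: (beval s b); last first.
  exists (bcost b), s; rewrite leq_addr bs; split=> //.
    by constructor; rewrite bs.
  by split=> //; exists k.
have [j jk Ij] := Istep k s Is bs.
have [t1 [s1 [e1 l1 E1]]] := runs_straight (Q := eq (run c s)) sc erefl.
rewrite -{s1}E1 in e1.
have [t2 [s2 [e2 l2 Q2]]] := IH _ jk _ Ij.
exists (bcost b + t1 + t2)%N, s2; split=> //; first exact: ExecWhileLoop e1 e2.
apply: leq_trans (leq_add (leqnn _) (leq_mul jk (leqnn (bcost b + max_cost c)))).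
by rewrite mulSn addnCA leq_add // leq_add2l.
Qed.

End ProgramLogic.

(** * The algorithm *)

(* Natural arrays: 3 degree, 4 sum of incident edge indices, 5 loop counter,
   6 current vertex, 7 number of removed vertices, 8 removed vertices in order,
   9 and 10 the edge to the parent and the parent of the current vertex.
   Real arrays: 3 and 4 hold S and f. *)
Definition scalar (a : nat) : nexp := NGet a (NConst 0).
Definition at_ (a x : nat) : nexp := NGet a (scalar x).

Definition count_body : cmd :=
  let incident a := Seq
    (NSet 3 (at_ a 5) (NAdd (NGet 3 (at_ a 5)) (NConst 1)))
    (NSet 4 (at_ a 5) (NAdd (NGet 4 (at_ a 5)) (scalar 5))) in
  Seq (Seq (incident 1) (incident 2))
      (NSet 5 (NConst 0) (NAdd (scalar 5) (NConst 1))).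

(** Subtracting the current vertex from the sum of the endpoints yields the other endpoint,
    whichever way the input orients the edge. *)
Definition load_edge : cmd :=
  Seq (NSet 9 (NConst 0) (at_ 4 6))
      (NSet 10 (NConst 0) (NSub (NAdd (at_ 1 9) (at_ 2 9)) (scalar 6))).

Definition root_sum : rexp :=
  RAdd (RSqrt (RGet 0 (scalar 9))) (RSqrt (RGet 3 (scalar 6))).

Definition branch : rexp := RMul root_sum root_sum.

(* The entry in array 4 of a removed vertex keeps the index of its parent edge,
   which [spread_body] reads again. *)
Definition remove_leaf : cmd :=
  Seq load_edge (
  Seq (NSet 3 (scalar 6) (NConst 0)) (
  Seq (NSet 3 (scalar 10) (NSub (at_ 3 10) (NConst 1))) (
  Seq (NSet 4 (scalar 10) (NSub (at_ 4 10) (scalar 9))) (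
  Seq (RSet 3 (scalar 10) (RAdd (RGet 3 (scalar 10)) branch)) (
  Seq (NSet 8 (scalar 7) (scalar 6)) (
  Seq (NSet 7 (NConst 0) (NAdd (scalar 7) (NConst 1)))
      (NSet 6 (NConst 0) (scalar 10)))))))).

Definition next_vertex : cmd :=
  Seq (NSet 5 (NConst 0) (NAdd (scalar 5) (NConst 1)))
      (NSet 6 (NConst 0) (scalar 5)).

(* Pruning continues at the parent when it becomes a leaf in turn, and otherwise
   with the next vertex of the scan; a parent that becomes a leaf later is
   reached from its last child. *)
Definition prune_body : cmd :=
  If (BAnd (BNot (BEqN (scalar 6) (NGet 0 (NConst 2))))
           (BEqN (at_ 3 6) (NConst 1)))
    remove_leaf next_vertex.

(** Array 8 is popped as a stack, so a parent receives its flow before its children do. *)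
Definition spread_body : cmd :=
  Seq (NSet 7 (NConst 0) (NSub (scalar 7) (NConst 1))) (
  Seq (NSet 6 (NConst 0) (at_ 8 7)) (
  Seq load_edge (
  Seq (RSet 4 (scalar 6)
        (RMul (RGet 4 (scalar 10)) (RDiv branch (RGet 3 (scalar 10)))))
      (RSet 1 (scalar 9)
        (RSqrt (RDiv (RMul (RGet 4 (scalar 6)) (RGet 0 (scalar 9)))
                     (RGet 3 (NGet 0 (NConst 2))))))))).

Definition count_guard : bexp := BLtN (scalar 5) (NGet 0 (NConst 1)).

Definition prune_guard : bexp := BLtN (scalar 5) (NGet 0 (NConst 0)).

Definition spread_guard : bexp := BLtN (NConst 0) (scalar 7).

Definition reset_scan : cmd :=
  Seq (NSet 5 (NConst 0) (NConst 0)) (NSet 6 (NConst 0) (NConst 0)).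

Definition start_spread : cmd := RSet 4 (NGet 0 (NConst 2)) (RConst 1).

Definition store_value : cmd := RSet 2 (NConst 0) (RGet 3 (NGet 0 (NConst 2))).

Definition budget_program : cmd :=
  Seq (While count_guard count_body) (
  Seq (Seq reset_scan (While prune_guard prune_body))
      (Seq start_spread (Seq (While spread_guard spread_body) store_value))).

(** * Effect of the loop bodies on memory *)

Section Correctness.

Variables (R : realType) (n m : nat) (ends : 'I_m -> 'I_n * 'I_n).
Variables (len : 'I_m -> R) (r : 'I_n).
Variables (ch pa : 'I_m -> 'I_n) (dep : 'I_n -> nat).
Hypothesis rt : rooting ends r ch pa dep.

Implicit Types (s : state R) (v : 'I_n) (e : 'I_m) (l : seq 'I_m).

Definition loaded s : Prop :=
  [/\ nmem s 0 0 = n, nmem s 0 1 = m, nmem s 0 2 = r,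
      forall e, nmem s 1 e = (ends e).1 /\ nmem s 2 e = (ends e).2
    & forall e, rmem s 0 e = len e].

Lemma loaded_other s e :
  loaded s -> (nmem s 1 e + nmem s 2 e - ch e = pa e)%N.
Proof.
case=> _ _ _ /(_ e)[-> ->] _.
by case: (rooting_ends rt e) => -> /=; rewrite (addKn, addnK).
Qed.

Lemma run_count_body s e : loaded s -> nmem s 5 0 = e ->
  let s' := run count_body s in
  [/\ loaded s', nmem s' 5 0 = e.+1, nmem s' 7 0 = nmem s 7 0, rmem s' = rmem s
    & forall v,
      let inc := (((ends e).1 == v) + ((ends e).2 == v))%N in
      nmem s' 3 v = (nmem s 3 v + inc)%N /\ nmem s' 4 v = (nmem s 4 v + inc * e)%N].
Proof.
move=> ld es; have [s0 s1 s2 /(_ e)[es1 es2] se] := ld.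
rewrite /= /update /= es es1 es2; split=> //; first by rewrite addn1.
move=> v; rewrite -!val_eqE /=; move: (nat_of_ord (ends e).1) (nat_of_ord v) => a x.
move: (nat_of_ord (ends e).2) => b.
rewrite ![_ == x]eq_sym.
have [->|xa] := eqVneq x a; have [ab|ab] := eqVneq _ b;
  rewrite /= ?ab ?eqxx ?addn0 ?mul0n ?addn0 ?mul1n //.
- by rewrite -!addnA mulSn mul1n.
- by rewrite -ab (negPf xa).
Qed.

Lemma run_remove_leaf s e :
  loaded s -> nmem s 6 0 = ch e -> nmem s 4 (ch e) = e ->
  let s' := run remove_leaf s in
  [/\ loaded s', nmem s' 5 0 = nmem s 5 0, nmem s' 6 0 = pa e
    & nmem s' 7 0 = (nmem s 7 0).+1] /\
  [/\ forall i, nmem s' 8 i = if i == nmem s 7 0 then val (ch e) else nmem s 8 i,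
      forall v, nmem s' 3 v = if v == pa e then (nmem s 3 v).-1 else
                              if v == ch e then 0%N else nmem s 3 v,
      forall v, nmem s' 4 v = if v == pa e then (nmem s 4 v - e)%N else nmem s 4 v
    & forall v, rmem s' 3 v = if v == pa e then
        rmem s 3 v + (Num.sqrt (len e) + Num.sqrt (rmem s 3 (ch e))) ^+ 2
      else rmem s 3 v].
Proof.
move=> ld cur es; have [s0 s1 s2 se sl] := ld; have other := loaded_other e ld.
rewrite /= /update /= cur es other sl -expr2.
have pc : (nat_of_ord (pa e) == ch e) = false.
  by rewrite eq_sym; apply: negbTE (ch_neq_pa rt e).
split; split=> //; rewrite ?addn1 //.
- by move=> v; rewrite -!val_eqE /= pc subn1; case: ifP => // /eqP ->.
- by move=> v; rewrite -!val_eqE /=; case: ifP => // /eqP ->.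
- by move=> v; rewrite -!val_eqE /=; case: ifP => // /eqP ->.
Qed.

Lemma run_spread_body s e k :
  loaded s -> nmem s 7 0 = k.+1 -> nmem s 8 k = ch e -> nmem s 4 (ch e) = e ->
  let s' := run spread_body s in
  [/\ loaded s', nmem s' 7 0 = k, nmem s' 8 = nmem s 8 & nmem s' 4 = nmem s 4] /\
  [/\ rmem s' 3 = rmem s 3,
      forall v, rmem s' 4 v = if v == ch e then
          rmem s 4 (pa e) *
          ((Num.sqrt (len e) + Num.sqrt (rmem s 3 (ch e))) ^+ 2 / rmem s 3 (pa e))
        else rmem s 4 v
    & forall e', rmem s' 1 e' = if e' == e then
          Num.sqrt (rmem s' 4 (ch e) * len e / rmem s 3 r)
        else rmem s 1 e'].
Proof.
move=> ld ks cur es; have [s0 s1 s2 se sl] := ld; have other := loaded_other e ld.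
by rewrite /= /update /= ks subn1 /= cur es other s2 sl -expr2 eqxx.
Qed.

End Correctness.

(** * Loop invariants *)

Section Loops.

Variables (R : realType) (n m : nat) (ends : 'I_m -> 'I_n * 'I_n).
Variables (len : 'I_m -> R) (r : 'I_n).
Variables (ch pa : 'I_m -> 'I_n) (dep : 'I_n -> nat).
Hypothesis rt : rooting ends r ch pa dep.

Implicit Types (s : state R) (v : 'I_n) (e : 'I_m) (l : seq 'I_m).

Local Notation loaded := (loaded ends len r).

Definition incidence e v : nat := (ch e == v) + (pa e == v).

Lemma incidence_ends e v :
  (((ends e).1 == v) + ((ends e).2 == v))%N = incidence e v.
Proof. by case: (rooting_ends rt e) => -> //=; rewrite addnC. Qed.

Definition counted (k : nat) s : Prop :=
  [/\ loaded s, nmem s 5 0 = k, nmem s 7 0 = 0%N, forall v, rmem s 3 v = 0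
    & forall v, nmem s 3 v = (\sum_(e < m | (e < k)%N) incidence e v)%N /\
                nmem s 4 v = (\sum_(e < m | (e < k)%N) incidence e v * e)%N].

Lemma counted_step e s :
  counted e s -> counted e.+1 (run count_body s).
Proof.
case=> ld es cnt S0 deg.
have := run_count_body ld es.
move: (run count_body s) => s' [ld' es' cnt' rm deg'].
split=> // [|v|v]; rewrite ?cnt' ?rm //.
have ltS (F : 'I_m -> nat) :
    (\sum_(e' < m | (e' < e.+1)%N) F e' = \sum_(e' < m | (e' < e)%N) F e' + F e)%N.
  rewrite (bigD1 e) //= addnC; congr (_ + _)%N; apply: eq_bigl => e'.
  by rewrite -val_eqE /= ltnS andbC -ltn_neqAle.
by have [-> ->] := deg' v; have [-> ->] := deg v; rewrite incidence_ends !ltS.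
Qed.

(* [l] lists removed edges, the last removed first. *)
Fixpoint leaf_order l : Prop :=
  if l is e :: l' then
    [/\ e \notin l', forall e', pa e' = ch e -> e' \in l' & leaf_order l']
  else True.

Fixpoint stored (mem : nat -> nat) l : Prop :=
  if l is e :: l' then mem (size l') = ch e /\ stored mem l' else True.

Lemma leaf_order_closed l e e' :
  leaf_order l -> e \in l -> pa e' = ch e -> e' \in l.
Proof.
elim: l => //= e0 l IH [_ h ol]; rewrite !inE => /predU1P[->|el] pe.
  by rewrite (h _ pe) orbT.
by rewrite (IH ol el pe) orbT.
Qed.

Lemma leaf_order_size l : leaf_order l -> (size l <= m)%N.
Proof.
move=> ol; rewrite -[X in (_ <= X)%N]card_ord.
suff /card_uniqP <- : uniq l by exact: max_card.
by elim: l ol => //= e l IH [-> _ /IH].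
Qed.

Lemma eq_stored mem mem' l :
  (forall i, (i < size l)%N -> mem i = mem' i) -> stored mem l -> stored mem' l.
Proof.
elim: l => //= e l IH eqm [<- sl]; split; first by rewrite eqm.
by apply: IH sl => i il; rewrite eqm // ltnW.
Qed.

(** In array 4 the parent edge of [v] is counted even after its removal, since [remove_leaf]
    subtracts the index at the parent only; hence the first sum ignores [l]. *)
Definition pruned l s : Prop :=
  [/\ loaded s, leaf_order l, stored (nmem s 8) l & nmem s 7 0 = size l] /\
  [/\ forall v, nmem s 3 v = (\sum_(e | e \notin l) incidence e v)%N,
      forall v, nmem s 4 v = (\sum_(e < m | ch e == v) e
                              + \sum_(e < m | (e \notin l) && (pa e == v)) e)%N
    & forall v, rmem s 3 v = \sum_(e | (e \in l) && (pa e == v))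
        (Num.sqrt (len e) + Num.sqrt (rmem s 3 (ch e))) ^+ 2].

Lemma counted_pruned s s' : counted m s ->
    nmem s' 3 = nmem s 3 -> nmem s' 4 = nmem s 4 -> nmem s' 7 = nmem s 7 ->
    rmem s' = rmem s -> loaded s' ->
  pruned [::] s'.
Proof.
case=> _ _ cnt S0 deg e3 e4 e7 er ld.
have all_lt (F : 'I_m -> nat) : (\sum_(e < m | (e < m)%N) F e = \sum_e F e)%N.
  by apply: eq_bigl => e; rewrite ltn_ord.
split; first by split; rewrite ?e7.
split=> v.
- by rewrite e3; have [-> _] := deg v; rewrite all_lt.
- rewrite e4; have [_ ->] := deg v; rewrite all_lt.
  rewrite [in X in (_ + X)%N]big_mkcond [in X in (X + _)%N]big_mkcond -big_split.
  by apply: eq_bigr => e _; rewrite mulnDl /=; do 2!case: eqP => _; rewrite ?mul1n.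
- by rewrite er S0 big_pred0.
Qed.

Lemma pruned_esum l s e : pruned l s -> e \in l -> nmem s 4 (ch e) = e.
Proof.
case=> [[_ ol _ _] [_ -> _]] el.
rewrite (big_pred1 e) => [|e']; last exact: (inj_eq (rooting_inj rt)).
rewrite big_pred0 ?addn0 // => e'; apply/negbTE/negP=> /andP[/negP el' /eqP pe].
exact/el'/(leaf_order_closed ol el pe).
Qed.

Lemma deg_notin l e v : e \notin l -> (\sum_(e' | e' \notin l) incidence e' v =
  incidence e v + \sum_(e' | e' \notin e :: l) incidence e' v)%N.
Proof.
move=> el; rewrite (bigD1 e) //=; congr (_ + _)%N; apply: eq_bigl => e'.
by rewrite inE negb_or andbC.
Qed.

Lemma incidence_ch e : incidence e (ch e) = 1%N.
Proof. by rewrite /incidence eqxx eq_sym (negPf (ch_neq_pa rt e)). Qed.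

Lemma incidence_pa e : incidence e (pa e) = 1%N.
Proof. by rewrite /incidence eqxx (negPf (ch_neq_pa rt e)). Qed.

(** If [e] were removed, so would be all edges below [ch e], and the degree would be 0. Hence [e]
    remains and accounts for the whole degree. *)
Lemma pruned_leaf l s e : pruned l s -> nmem s 3 (ch e) = 1%N ->
  e \notin l /\ forall e', pa e' = ch e -> e' \in l.
Proof.
case=> [[_ ol _ _] [-> _ _]] deg1.
have el : e \notin l.
  apply/negP=> el; move: deg1; rewrite big1 // => e' el'; apply/eqP.
  rewrite /incidence addn_eq0 !eqb0; apply/andP; split; apply/eqP => pe.
    by rewrite (rooting_inj rt pe) el in el'.
  by rewrite (leaf_order_closed ol el pe) in el'.
split=> // e' pe; apply: contraT => el'.
move/eqP: deg1; rewrite (deg_notin _ el) incidence_ch add1n eqSS sum_nat_eq0.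
have ne : e' != e.
  by apply/eqP => ee; have := ch_neq_pa rt e; rewrite -pe ee eqxx.
move/forallP/(_ e'); rewrite inE negb_or ne (negbTE el') /=.
by rewrite /incidence pe eqxx addn1.
Qed.

Lemma pruned_step l s e :
    pruned l s -> nmem s 6 0 = ch e -> nmem s 3 (ch e) = 1%N ->
  let s' := run remove_leaf s in
  [/\ pruned (e :: l) s', nmem s' 5 0 = nmem s 5 0, nmem s' 6 0 = pa e
    & forall v, v != pa e -> v != ch e -> nmem s' 3 v = nmem s 3 v].
Proof.
move=> pr cur deg1; have [el leaf] := pruned_leaf pr deg1.
have [[ld ol st cnt] [deg esum sums]] := pr.
have es : nmem s 4 (ch e) = e.
  rewrite esum (big_pred1 e) => [|e']; last exact: (inj_eq (rooting_inj rt)).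
  rewrite big_pred0 ?addn0 // => e'; apply/negbTE/negP=> /andP[/negP el' /eqP].
  by move=> /leaf /el'.
have := run_remove_leaf rt ld cur es.
move: (run remove_leaf s) => s' [[ld' i' cur' cnt'] [ord' deg' esum' sum']] /=.
split=> //; last by move=> v vp vc; rewrite deg' (negPf vp) (negPf vc).
split; first split=> //.
- split; first by rewrite ord' cnt eqxx.
  apply: eq_stored st => i il; rewrite ord' cnt; case: eqP => // ie.
  by rewrite ie ltnn in il.
- by rewrite cnt' cnt.
split=> v.
- rewrite deg' deg (deg_notin _ el).
  have [->|vp] := eqVneq v (pa e); first by rewrite incidence_pa.
  have [->|vc] := eqVneq v (ch e).
    by move: deg1; rewrite deg (deg_notin _ el) incidence_ch add1n => -[->].
  by rewrite /incidence ![_ == v]eq_sym (negPf vp) (negPf vc).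
- rewrite esum' esum.
  have [->|vp] := eqVneq v (pa e).
    rewrite [X in (_ + X - _)%N](bigD1 e) ?el ?eqxx //= addnCA addKn.
    congr (_ + _)%N; apply: eq_bigl => e'.
    by rewrite inE negb_or andbC andbA.
  congr (_ + _)%N; apply: eq_bigl => e'; rewrite inE negb_or -andbA.
  by have [->|] := eqVneq e' e; rewrite // eq_sym (negPf vp) andbF.
(* The only write is at [pa e]. If that were the child end of an edge in [l], then [e] would already
   be in [l]. *)
- have sum_ch e' : e' \in e :: l -> rmem s' 3 (ch e') = rmem s 3 (ch e').
    rewrite sum' inE => /predU1P[->|el']; first by rewrite (negPf (ch_neq_pa rt e)).
    case: eqP => // pe; have := leaf_order_closed ol el' (esym pe).
    by rewrite (negPf el).
  rewrite (eq_bigr (fun e' =>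
      (Num.sqrt (len e') + Num.sqrt (rmem s 3 (ch e'))) ^+ 2)); last first.
    by move=> e' /andP[/sum_ch -> _].
  rewrite sum' [in LHS]sums.
  have [->|vp] := eqVneq v (pa e).
    rewrite [RHS](bigD1 e) ?inE ?eqxx //= addrC; congr (_ + _).
    apply: eq_bigl => e'; rewrite inE.
    by have [->|] := eqVneq e' e; rewrite ?(negPf el) ?andbF ?andbT.
  apply: eq_bigl => e'; rewrite inE.
  by have [->|] := eqVneq e' e; rewrite // eq_sym (negPf vp) andbF.
Qed.

(* The scan leaves no leaf behind it, except possibly the current vertex. *)
Definition scanned (i : nat) s : Prop :=
  [/\ (i <= n)%N, nmem s 5 0 = i, (nmem s 6 0 < n)%N = (i < n)%N
    & forall v, (v <= i)%N -> val v != nmem s 6 0 -> v != r -> nmem s 3 v != 1%N].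

(** The variant adds scan positions and edges still to go; each iteration lowers one of the two,
    which gives at most [n + m] iterations. *)
Definition pruning (j : nat) s : Prop :=
  exists i l, [/\ pruned l s, scanned i s & j = (n - i + (m - size l))%N].

Lemma pruning_step j s : pruning j s -> (nmem s 5 0 < n)%N ->
  exists2 j', (j' < j)%N & pruning j' (run prune_body s).
Proof.
case=> i [l [pr [ile si ci deg_scanned] ->]]; rewrite si => iln.
have [[ld ol st cnt] _] := pr; have [s0 s1 s2 _ _] := ld.
have -> : run prune_body s = if (nmem s 6 0 != r) && (nmem s 3 (nmem s 6 0) == 1%N)
    then run remove_leaf s else run next_vertex s.
  by rewrite -s2.
rewrite iln in ci; pose c := Ordinal ci; have cE : nmem s 6 0 = c by [].
rewrite cE; case: ifP => [/andP[cr /eqP deg1]|ncond].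
- have /(rooting_surj rt)[e ec] : c != r by [].
  rewrite -ec in cE deg1.
  have := pruned_step pr cE deg1.
  move: (run remove_leaf s) => s' [pr' si' cur' deg'].
  have [[_ ol' _ _] [deg'' _ _]] := pr'.
  exists (n - i + (m - size (e :: l)))%N.
    by have := leaf_order_size ol'; rewrite /= ltn_add2l => sz; apply: ltn_sub2l.
  exists i, (e :: l); split=> //; split=> [//|||v vi].
  + by rewrite si'.
  + by rewrite cur' ltn_ord iln.
  (* Only two degrees change: that of [ch e] drops to 0, and [pa e] is exempt as the new current
     vertex. *)
  + rewrite cur' val_eqE => vp vr.
  have [->|vc] := eqVneq v (ch e).
    have [el _] := pruned_leaf pr deg1.
    have [[_ _ _ _] [deg _ _]] := pr.
    move: deg1; rewrite deg'' deg (deg_notin _ el) incidence_ch add1n.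
    by case=> ->.
  by rewrite deg' //; apply: deg_scanned; rewrite // cE val_eqE.
- exists (n - i.+1 + (m - size l))%N.
    by rewrite ltn_add2r; apply: ltn_sub2l.
  exists i.+1, l; split=> //; split=> //=; rewrite /update /= si addn1 //.
  move=> v; rewrite leq_eqVlt ltnS => /orP[/eqP ->|vi]; first by rewrite eqxx.
  (* The old current vertex loses its exemption, but the failed test shows that its degree is not
     1. *)
  move=> _ vr; have [vc|vc] := eqVneq v c.
    by move: ncond; rewrite -vc val_eqE vr /= => ->.
  by apply: deg_scanned; rewrite // cE val_eqE.
Qed.

(** After the scan the current vertex is out of range, so no vertex is exempt. Bottom-up, once all
    edges below [v] are removed, a remaining parent edge would give [v] degree 1. *)
Lemma pruned_all l s : pruned l s -> scanned n s -> forall e, e \in l.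
Proof.
move=> [_ [deg _ _]] [_ _ cn deg_scanned].
suff all v : forall e, ch e = v -> e \in l by move=> e; apply: (all (ch e)).
elim/(rooted_ind_up rt): v => v IH e ev; apply: contraT => el.
have : nmem s 3 v != 1%N.
  apply: deg_scanned; rewrite -?ev ?(rooting_neq_root rt) ?(ltnW (ltn_ord _)) //.
  by apply/eqP => ce; rewrite -ce ltn_ord ltnn in cn.
rewrite deg (deg_notin _ el) -ev incidence_ch big1 // => e' el'.
apply/eqP; rewrite /incidence addn_eq0 !eqb0; apply/andP; split; apply: contra el'.
  by move/eqP/(rooting_inj rt) ->; rewrite inE eqxx.
by rewrite ev inE => /eqP pe; rewrite (IH e' pe) ?orbT.
Qed.

Lemma pruning_done j s : pruning j s -> ~~ (nmem s 5 0 < n)%N ->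
  exists2 l, pruned l s & forall e, e \in l.
Proof.
case=> i [l [pr sc _]]; have [ile -> _ _] := sc; rewrite -leqNgt => ige.
have ni : i = n by apply/eqP; rewrite eqn_leq ile.
by exists l => //; rewrite ni in sc; apply: pruned_all sc.
Qed.

Section Spread.

Variable S : 'I_n -> R.

Definition spread l s : Prop :=
  [/\ loaded s, leaf_order l, stored (nmem s 8) l, nmem s 7 0 = size l
    & forall e, nmem s 4 (ch e) = e] /\
  [/\ forall v, rmem s 3 v = S v, rmem s 4 r = 1,
      forall e, e \notin l -> rmem s 4 (ch e) = rmem s 4 (pa e) *
        ((Num.sqrt (len e) + Num.sqrt (S (ch e))) ^+ 2 / S (pa e))
    & forall e, e \notin l ->
        rmem s 1 e = Num.sqrt (rmem s 4 (ch e) * len e / S r)].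

(** The new flow value at [ch e] disturbs no equation already established: edges with parent [ch e]
    are still in [l] by [leaf_order]. *)
Lemma spread_step e l s : spread (e :: l) s -> spread l (run spread_body s).
Proof.
case=> -[ld ol [se st] cnt esum] [sums fr fch Bch].
have [el leaf ol'] : leaf_order (e :: l) by [].
have := run_spread_body rt ld cnt se (esum e).
move: (run spread_body s) => s' [[ld' cnt' ord' esum'] [sum' f' B']].
split; first by split=> //; rewrite ?ord' // => e'; rewrite esum'.
have f_ch e' : e' != e -> rmem s' 4 (ch e') = rmem s 4 (ch e').
  by move=> ne; rewrite f' (inj_eq (rooting_inj rt)) (negPf ne).
have f_pa e' : e' \notin l -> rmem s' 4 (pa e') = rmem s 4 (pa e').
  by rewrite f'; case: eqP => // /leaf ->.
split=> [v||e' el'|e' el'].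
- by rewrite sum'.
- by rewrite f' eq_sym (negPf (rooting_neq_root rt e)).
- rewrite f_pa //; have [->|ne] := eqVneq e' e; first by rewrite f' eqxx !sums.
  by rewrite f_ch // fch // inE negb_or ne.
- rewrite B' sums; have [->//|ne] := eqVneq e' e.
  by rewrite f_ch // Bch // inE negb_or ne.
Qed.

Definition spreading (j : nat) s : Prop := exists2 l, spread l s & size l = j.

Lemma spreading_step j s : spreading j s -> (0 < nmem s 7 0)%N ->
  exists2 j', (j' < j)%N & spreading j' (run spread_body s).
Proof.
case=> [[|e l] sp <-]; have [[_ _ _ cnt _] _] := sp; rewrite cnt // => _.
by exists (size l) => //; exists l => //; apply: spread_step sp.
Qed.

End Spread.

End Loops.

(** * Running time and output of the three phases *)

Section Program.

Variables (R : realType) (n m : nat) (ends : 'I_m -> 'I_n * 'I_n).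
Variables (len : 'I_m -> R) (r : 'I_n).
Variables (ch pa : 'I_m -> 'I_n) (dep : 'I_n -> nat).
Hypothesis rt : rooting ends r ch pa dep.
Hypothesis len_gt0 : forall e, 0 < len e.

Lemma input_counted : counted ends len r ch pa 0 (input ends len r).
Proof.
split=> // [|v]; last by rewrite !big_pred0.
have nth_enum (T : Type) (x0 : T) (F : 'I_m -> T) (e : 'I_m) :
    nth x0 [seq F e' | e' <- enum 'I_m] e = F e.
  by rewrite (nth_map e) ?size_enum_ord // nth_ord_enum.
by split=> // e /=; rewrite !nth_enum.
Qed.

Lemma count_runs :
  runs (While count_guard count_body) (input ends len r)
    (bcost count_guard + m * (bcost count_guard + max_cost count_body))
    (counted ends len r ch pa m).
Proof.
pose I (j : nat) s := exists k,
  [/\ counted ends len r ch pa k s, (k <= m)%N & j = (m - k)%N].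
have I0 : I m (input ends len r).
  by exists 0%N; rewrite subn0; split=> //; apply: input_counted.
apply: (runs_imply _ (runs_while (I := I) _ I0 _)) => //.
  move=> s [/[swap] -[j [k [cs km _]]]]; have [[_ s1 _ _ _] sk _ _ _] := cs.
  rewrite /= sk s1 -leqNgt => mk.
  by have km' : k = m; [apply/eqP; rewrite eqn_leq km | rewrite km' in cs].
move=> j s [k [cs km ->]]; have [[_ s1 _ _ _] sk _ _ _] := cs.
rewrite [beval _ _]/= sk s1 => ltkm; exists (m - k.+1)%N; first exact: ltn_sub2l.
by exists k.+1; split=> //; apply: (counted_step rt (e := Ordinal ltkm)).
Qed.

Lemma prune_runs s : counted ends len r ch pa m s ->
  runs (Seq reset_scan (While prune_guard prune_body)) s
    (max_cost reset_scan
     + (bcost prune_guard + (n + m) * (bcost prune_guard + max_cost prune_body)))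
    (fun s' => exists2 l, pruned ends len r ch pa l s' & forall e, e \in l).
Proof.
move=> cs.
apply: (@runs_seq _ _ _ _ _ _ (pruning ends len r ch pa (n + m))) => [|s' prs].
  apply: runs_straight => //; exists 0%N, [::]; rewrite !subn0; split=> //.
    by have [ld _ _ _ _] := cs; apply: (counted_pruned cs).
  by split=> //= v; rewrite leqn0 => ->.
apply: (runs_imply _ (runs_while (I := pruning ends len r ch pa) _ prs _)) => //.
  move=> s1 [/[swap] -[j pr]].
  have [i [l [[[[s0 _ _ _ _] _ _ _] _] _ _]]] := pr.
  by rewrite /= s0; apply: (pruning_done rt pr).
move=> j s1 pr; have [i [l [[[[s0 _ _ _ _] _ _ _] _] _ _]]] := pr.
by rewrite [beval _ _]/= s0; apply: (pruning_step rt).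
Qed.

Lemma spread_runs s l : pruned ends len r ch pa l s -> (forall e, e \in l) ->
  runs (Seq start_spread (Seq (While spread_guard spread_body) store_value)) s
    (max_cost start_spread
     + (bcost spread_guard + m * (bcost spread_guard + max_cost spread_body)
        + max_cost store_value))
    (fun s' => (0 < m)%N ->
       optimal_budget ends len r (output_budget (m := m) s') /\
       (output_value s')%:E = BR ends len r).
Proof.
move=> pr all_l; pose S (v : 'I_n) := rmem s 3 v.
have [[ld ol st cnt] [_ _ sums]] := pr; have [s0 s1 s2 se sl] := ld.
(* With every edge in [l], the partial sums of the pruning invariant are complete. *)
have S_rec v : S v = \sum_(e | pa e == v)
    (Num.sqrt (len e) + Num.sqrt (S (ch e))) ^+ 2.
  by rewrite [LHS]sums; apply: eq_bigl => e; rewrite all_l.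
have szl := leaf_order_size ol.
apply: (@runs_seq _ _ _ _ _ _ (spreading ends len r ch pa S (size l))) => [|s' sp].
  apply: runs_straight => //; exists l => //; split; split=> //=.
  - by move=> e; apply: (pruned_esum rt pr (all_l e)).
  - by rewrite /update s2 !eqxx.
  - by move=> e; rewrite all_l.
  - by move=> e; rewrite all_l.
apply: (@runs_seq _ _ _ _ _ _ (spread ends len r ch pa S [::])) => [|s3 sp3].
  have le_m : (bcost spread_guard
      + size l * (bcost spread_guard + max_cost spread_body) <= bcost spread_guard + m * (bcost spread_guard + max_cost spread_body))%N.
    by rewrite leq_add2l leq_mul2r szl orbT.
  apply: (runs_le le_m (runs_imply _ (runs_while (I := spreading ends len r ch pa S)
    _ sp _))) => //; last by move=> j s3; apply: (spreading_step rt).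
  move=> s3 [nguard [j [[|e l'] sp' _]]] //.
  by move: nguard; have [[_ _ _ cnt' _] _] := sp'; rewrite /= cnt'.
apply: runs_straight => // m_gt0.
have [[[t0 t1 t2 te tl] _ _ _ _] [sums3 f_root f_ch B_def]] := sp3.
(* The stack is empty, so the equations hold at every edge; [isT] proves [e \notin [::]]. *)
have := B_optimal rt len_gt0 S_rec (f := fun v : 'I_n => rmem s3 4 v) f_root
  (fun e => f_ch e isT) (inhabits (Ordinal m_gt0)) (fun e => B_def e isT).
have -> : output_value (run store_value s3) = S r.
  by rewrite /output_value /= /update /= t2 sums3.
by [].
Qed.

End Program.

Theorem theorem1 (R : realType) :
  exists (p : cmd) (C : nat),
  forall (n m : nat) (ends : 'I_m -> 'I_n * 'I_n) (len : 'I_m -> R) (r : 'I_n),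
    is_tree ends -> (forall e : 'I_m, 0 < len e) ->
    exists (t : nat) (s : state R),
      [/\ exec p (input ends len r) t s,
          (t <= C * (n + m))%N
        & (0 < m)%N ->
          optimal_budget ends len r (output_budget (m := m) s) /\
          (output_value s)%:E = BR ends len r].
Proof.
pose loop_cost b c := (bcost b + (bcost b + max_cost c))%N.
exists budget_program.
exists (loop_cost count_guard count_body
  + (max_cost reset_scan + loop_cost prune_guard prune_body
     + (max_cost start_spread + (loop_cost spread_guard spread_body
                                 + max_cost store_value))))%N.
move=> n m ends len r tree len_gt0.
have [ch [pa [dep rt]]] := tree_rooting r tree.
(* The root makes [n] positive, so additive constants are absorbed into the linear bound. *)
have nm_gt0 : (0 < n + m)%N.
  by rewrite (leq_trans _ (leq_addr _ _)) // (leq_trans _ (ltn_ord r)).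
apply: runs_le; last first.
  apply: (runs_seq (count_runs len rt)) => s cs.
  apply: (runs_seq (prune_runs rt cs)) => s' [l pr all_l].
  exact: (spread_runs rt len_gt0 pr all_l).
have cost_le c : (c <= c * (n + m))%N by apply: leq_pmulr.
have loop_le b c k : (k <= n + m)%N ->
    (bcost b + k * (bcost b + max_cost c) <= loop_cost b c * (n + m))%N.
  by move=> k_le; rewrite mulnDl leq_add ?cost_le // mulnC leq_mul2l k_le orbT.
have add_le a b x y : (a <= x * (n + m))%N -> (b <= y * (n + m))%N ->
    (a + b <= (x + y) * (n + m))%N by rewrite mulnDl; apply: leq_add.
exact: add_le (loop_le _ _ _ (leq_addl _ _))
  (add_le _ _ _ _ (add_le _ _ _ _ (cost_le _) (loop_le _ _ _ (leqnn _)))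
    (add_le _ _ _ _ (cost_le _)
      (add_le _ _ _ _ (loop_le _ _ _ (leq_addl _ _)) (cost_le _)))).
Qed.
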